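(* Let $\phi$ be an MTL$^{\downarrow}$ formula, $\mu$ a partial valuation, $\nu$ a total valuation, $u$ an observation, $v$ a timed word, and $\tau\in\mathbb{Q}_{\geq 0}$. If $u\sqsubseteq v$ and $\mu\sqsubseteq\nu$, then $[\![\phi]\!]^{\tau}_{u,\mu}\preceq[\![\phi]\!]^{\mathrm{B},\tau}_{v,\nu}$.
   Context: Setting. Fix a finite set $P$ of predicate symbols with arities $\iota(p)$, a set $V$ of variables, a finite set $R$ of registers, and a nonempty data domain $D$ with $\bot\notin D$. MTL$^{\downarrow}$ formulas: $\phi ::= \mathsf{t}\mid p(x_1,\dots,x_{\iota(p)})\mid {\downarrow^{r}}x.\,\phi\mid\neg\phi\mid\phi\vee\phi\mid \bullet_I\phi\ (\text{previous})\mid \circ_I\phi\ (\text{next})\mid\phi\,\mathsf{S}_I\,\phi\mid\phi\,\mathsf{U}_I\,\phi$, with $I$ an interval of $\mathbb{Q}_{\geq0}$ and ${\downarrow^r}x$ the freeze quantifier binding $x$ to the value of register $r$. For intervals, $A-B:=\{a-b\mid a\in A,b\in B\}\cap\mathbb{Q}_{\geq0}$. Truth values $\{\mathsf{t},\mathsf{f},\bot\}$ with strong Kleene connectives $\neg,\vee,\wedge,\to$ and knowledge order $\bot\prec\mathsf{t}$, $\bot\prec\mathsf{f}$ ($\mathsf{t},\mathsf{f}$ incomparable); $\preceq$ is its reflexive closure. Alphabet $\Sigma$: pairs $(\sigma,\rho)$ of partial functions $\sigma:P\rightharpoonup\bigcup_p 2^{D^{\iota(p)}}$, $\rho:R\rightharpoonup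 D$, ordered by $f\sqsubseteq g$ iff $g$ extends $f$; the least element is the pair of everywhere-undefined maps. Observations are finite words of letters $(I,a)$ ($I$ an interval, $a\in\Sigma$), defined inductively: $([0,\infty),a_0)$ with $a_0$ the least letter is an observation; applying to an observation one of (T1) replace a letter $(I,a)$ with $|I|>1$ by $(I\cap[0,\tau),a)(\{\tau\},a)(I\cap(\tau,\infty),a)$ for some $\tau\in I$, $\tau>0$ (for $\tau=0$: by $(\{0\},a)(I\cap(0,\infty),a)$), (T2) remove a letter $(I,a)$ with $|I|>1$ and $I$ bounded, (T3) replace a letter $(I,a)$ with $|I|=1$ by $(I,a')$ with $a\sqsubseteq a'$, yields an observation. Position $i$ is a time point if its interval $I_i$ is a singleton; its element is its timestamp. A timed word $v=(\tau_0,(\sigma'_0,\rho'_0))(\tau_1,(\sigma'_1,\rho'_1))\dots$ (total $\sigma'_j,\rho'_j$, strictly increasing nonzeno timestamps) refines an observation $u=(I_0,(\sigma_0,\rho_0))\dots(I_{n-1},(\sigma_{n-1},\rho_{n-1}))$, written $u\sqsubseteq v$, if for every $j$ there is $i$ with $\tau_j\in I_i$, $\sigma_i\sqsubseteq\sigma'_j$, $\rho_i\sqsubseteq\rho'_j$. For valuations, $\mu\sqsubseteq\nu$ means $\nu$ extends $\mu$. Three-valued semantics $[\![\phi]\!]_{w,i,\nu}$ for observation $w$, position $i$, partial valuation $\nu$: $[\![\mathsf{t}]\!]=\mathsf{t}$; $[\![p(\bar x)]\!]_{w,i,\nu}$ is $\mathsf{t}$ (resp. $\mathsf{f}$) if $\bar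 x\subseteq\mathrm{def}(\nu)$, $p\in\mathrm{def}(\sigma_i)$ and $\nu(\bar x)\in\sigma_i(p)$ (resp. $\notin$), else $\bot$; $[\![{\downarrow^r}x.\phi]\!]_{w,i,\nu}=[\![\phi]\!]_{w,i,\nu[x\mapsto\rho_i(r)]}$ if $r\in\mathrm{def}(\rho_i)$, otherwise $[\![\phi]\!]_{w,i,\nu'}$ with $\nu'$ equal to $\nu$ but undefined at $x$; $\neg,\vee$ via Kleene. With $\mathrm{tp}_w(i)=\mathsf{t}$ if $|I_i|=1$ else $\bot$, and $\mathrm{mc}_{w,I}(i,j)=\mathsf{t}$ if $I_i-I_j\neq\emptyset$ and $I_i-I_j\subseteq I$, $\mathsf{f}$ if $(I_i-I_j)\cap I=\emptyset$, $\bot$ otherwise: $[\![\phi\,\mathsf{S}_I\psi]\!]_{w,i,\nu}=\bigvee_{j\le i}\big(\mathrm{tp}_w(j)\wedge\mathrm{mc}_{w,I}(i,j)\wedge[\![\psi]\!]_{w,j,\nu}\wedge\bigwedge_{j<k\le i}(\mathrm{tp}_w(k)\to[\![\phi]\!]_{w,k,\nu})\big)$, and $[\![\phi\,\mathsf{U}_I\psi]\!]_{w,i,\nu}=\bigvee_{j\ge i}\big(\mathrm{tp}_w(j)\wedge\mathrm{mc}_{w,I}(j,i)\wedge[\![\psi]\!]_{w,j,\nu}\wedge\bigwedge_{i\le k<j}(\mathrm{tp}_w(k)\to[\![\phi]\!]_{w,k,\nu})\big)$; $[\![\bullet_I\phi]\!]_{w,i,\nu}=c_0\vee c_{-1}\vee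 c_{-2}$ and $[\![\circ_I\phi]\!]_{w,i,\nu}=c_0\vee c_1\vee c_2$, where $c_0=\mathrm{mc}_{w,I}(i,i)\wedge[\![\phi]\!]_{w,i,\nu}\wedge\neg\mathrm{tp}_w(i)$ if $I\neq\{0\}$; $c_{-1}=\mathrm{mc}_{w,I}(i,i-1)\wedge[\![\phi]\!]_{w,i-1,\nu}\wedge\mathrm{tp}_w(i-1)\wedge\mathrm{tp}_w(i)$ if $i\ge1$; $c_1=\mathrm{mc}_{w,I}(i+1,i)\wedge[\![\phi]\!]_{w,i+1,\nu}\wedge\mathrm{tp}_w(i+1)\wedge\mathrm{tp}_w(i)$ if $i<n-1$; $c_{-2}=\mathrm{mc}_{w,I}(i,i-2)\wedge[\![\phi]\!]_{w,i-2,\nu}\wedge\neg\mathrm{tp}_w(i-1)$ if $i\ge2$; $c_2=\mathrm{mc}_{w,I}(i+2,i)\wedge[\![\phi]\!]_{w,i+2,\nu}\wedge\neg\mathrm{tp}_w(i+1)$ if $i<n-2$; each $c_k$ is $\mathsf{f}$ when its side condition fails. Timestamp version: $[\![\phi]\!]^{\tau}_{w,\nu}:=[\![\phi]\!]_{w,i,\nu}$ if $\tau$ is the timestamp of a time point $i$ of $w$, and $\bot$ otherwise. Boolean semantics on a timed word $v$ with total valuation $\nu$ is the standard one ($\mathsf{S}_I,\mathsf{U}_I$ with metric constraint $\tau_i-\tau_j\in I$, resp. $\tau_j-\tau_i\in I$; $\circ_I\phi$ holds at $i$ iff $\tau_{i+1}-\tau_i\in I$ and $\phi$ holds at $i+1$;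 $\bullet_I\phi$ iff $i>0$, $\tau_i-\tau_{i-1}\in I$ and $\phi$ at $i-1$; ${\downarrow^r}x.\phi$ evaluates $\phi$ under $\nu[x\mapsto\rho'_i(r)]$). $[\![\phi]\!]^{\mathrm{B},\tau}_{v,\nu}$ denotes the Boolean value at position $j$ if $\tau_j=\tau$, and $\bot$ if no position of $v$ has timestamp $\tau$.
   Formalization: The relation u ⊑ v is strengthened to require also that the timestamp of every time point of u is a timestamp of v; without this the claim fails, e.g. for φ = t, u with time point 1/2, v with timestamps 0,1,2,… and τ = 1/2. *)

(* Defs.v *)
From HB Require Import structures.
From mathcomp Require Import all_boot all_order all_algebra.
From mathcomp Require Import boolp classical_sets set_interval num_normedtype.

Set Implicit Arguments.
Unset Strict Implicit.
Unset Printing Implicit Defensive.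
Import Order.TTheory GRing.Theory Num.Theory.
Local Open Scope classical_set_scope.
Local Open Scope ring_scope.

(* An interval of the nonnegative rationals is an order-convex subset: it may
   have irrational cuts, and it may be empty. *)
Record tinterval := TInterval {
  tset :> set rat;
  tset_itv : is_interval tset;
  tset_ge0 : tset `<=` [set t | 0 <= t]
}.

Lemma nnegq_itv : is_interval [set t : rat | 0 <= t].
Proof. by move=> x y /= x0 _ z /andP[xz _]; exact: le_trans x0 xz. Qed.

Definition nnegq : tinterval := TInterval nnegq_itv (@subset_refl _ _).

Lemma tcap_itv (I : tinterval) (i : interval rat) :
  is_interval (I `&` [set` i]).
Proof.
move=> x y [Ix ix] [Iy iy] z xyz.
split; first exact: tset_itv Ix Iy _ xyz.
exact: interval_is_interval ix iy _ xyz.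
Qed.

Lemma tcap_ge0 (I : tinterval) (i : interval rat) :
  I `&` [set` i] `<=` [set t | 0 <= t].
Proof. by move=> t [/tset_ge0]. Qed.

Definition tcap (I : tinterval) (i : interval rat) : tinterval :=
  TInterval (@tcap_itv I i) (@tcap_ge0 I i).

Definition tpoint (t : rat) : tinterval := tcap nnegq `[t, t].

(* |I| = 1 and |I| > 1 *)
Definition is_singleton (A : set rat) : Prop := exists t, A = [set t].
Definition is_large (A : set rat) : Prop := exists s t, [/\ A s, A t & s != t].

Definition tdiff (A B : set rat) : set rat :=
  [set c | 0 <= c /\ exists a b, [/\ A a, B b & c = a - b]].

(* Three-valued logic: [Some true], [Some false] and [None] are t, f and
   bottom. *)
Definition tv := option bool.

Definition kneg (a : tv) : tv := omap negb a.

Definition kor (a b : tv) : tv :=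
  match a, b with
  | Some true, _ | _, Some true => Some true
  | Some false, Some false => Some false
  | _, _ => None
  end.

Definition kand (a b : tv) : tv :=
  match a, b with
  | Some false, _ | _, Some false => Some false
  | Some true, Some true => Some true
  | _, _ => None
  end.

Definition kimp (a b : tv) : tv := kor (kneg a) b.

Definition kle (a b : tv) : Prop := a = None \/ a = b.

(* [None] means undefined.  The family B allows the codomain to depend on the
   argument, as it does for predicate interpretations. *)
Definition extends (T : Type) (B : T -> Type) (f g : forall x, option (B x)) :
  Prop := forall x y, f x = Some y -> g x = Some y.

Definition as_partial (T : Type) (B : T -> Type) (f : forall x, B x) :
  forall x, option (B x) := fun x => Some (f x).

Section MTL.

Variables (P R : finType) (ar : P -> nat) (V : eqType) (D : Type).

Inductive formula :=
  | FTrue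
  | FPred (p : P) of (ar p).-tuple V
  | FFreeze of R & V & formula
  | FNeg of formula
  | FOr of formula & formula
  | FPrev of tinterval & formula
  | FNext of tinterval & formula
  | FSince of tinterval & formula & formula
  | FUntil of tinterval & formula & formula.

Record letter := Letter {
  preds : forall p : P, option (set ((ar p).-tuple D));
  regs : R -> option D
}.

Definition letter0 : letter := Letter (fun=> None) (fun=> None).

Definition letter_le (a b : letter) : Prop :=
  extends (preds a) (preds b) /\ extends (regs a) (regs b).

Definition word := seq (tinterval * letter).

Inductive obs_step : word -> word -> Prop :=
  | StepSplit (w1 w2 : word) (I : tinterval) (a : letter) (t : rat) :
      is_large I -> tset I t -> 0 < t ->
      obs_step (w1 ++ (I, a) :: w2)
               (w1 ++ [:: (tcap I `[0, t[, a), (tpoint t, a),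
                          (tcap I `]t, +oo[, a) & w2])
  | StepSplit0 (w1 w2 : word) (I : tinterval) (a : letter) :
      is_large I -> tset I 0 ->
      obs_step (w1 ++ (I, a) :: w2)
               (w1 ++ [:: (tpoint 0, a), (tcap I `]0, +oo[, a) & w2])
  | StepRemove (w1 w2 : word) (I : tinterval) (a : letter) :
      is_large I -> has_ubound I ->
      obs_step (w1 ++ (I, a) :: w2) (w1 ++ w2)
  | StepData (w1 w2 : word) (I : tinterval) (a a' : letter) :
      is_singleton I -> letter_le a a' ->
      obs_step (w1 ++ (I, a) :: w2) (w1 ++ (I, a') :: w2).

Inductive observation : word -> Prop :=
  | ObsInit : observation [:: (nnegq, letter0)]
  | ObsStep (w w' : word) : observation w -> obs_step w w' -> observation w'.

(* Junk values for i >= size w. *)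
Definition itv_at (w : word) (i : nat) : tinterval :=
  (nth (nnegq, letter0) w i).1.
Definition letter_at (w : word) (i : nat) : letter :=
  (nth (nnegq, letter0) w i).2.

Definition tp (w : word) (i : nat) : tv :=
  if `[< is_singleton (itv_at w i) >] then Some true else None.

Definition mc (w : word) (I : tinterval) (i j : nat) : tv :=
  let d := tdiff (itv_at w i) (itv_at w j) in
  if `[< d !=set0 /\ d `<=` I >] then Some true
  else if `[< d `&` I = set0 >] then Some false
  else None.

Definition atom (n : nat) (X : option (set (n.-tuple D))) (xs : n.-tuple V)
    (nu : V -> option D) : tv :=
  if `[< exists ds A, [/\ map_tuple nu xs = map_tuple Some ds,
                          X = Some A & A ds] >] then Some true
  else if `[< exists ds A, [/\ map_tuple nu xs = map_tuple Some ds,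
                               X = Some A & ~ A ds] >] then Some false
  else None.

(* In the freeze case the register content is an option, so that x becomes
   undefined when r is. *)
Fixpoint sem (w : word) (phi : formula) (i : nat) (nu : V -> option D) : tv :=
  match phi with
  | FTrue => Some true
  | FPred p xs => atom (preds (letter_at w i) p) xs nu
  | FFreeze r x phi => sem w phi i [eta nu with x |-> regs (letter_at w i) r]
  | FNeg phi => kneg (sem w phi i nu)
  | FOr phi psi => kor (sem w phi i nu) (sem w psi i nu)
  | FPrev J phi =>
      let c0 := if `[< tset J = [set 0] >] then Some false
                else kand (mc w J i i) (kand (sem w phi i nu)
                       (kneg (tp w i))) in
      let c1 := if (1 <= i)%N
                then kand (mc w J i i.-1) (kand (sem w phi i.-1 nu)
                       (kand (tp w i.-1) (tp w i)))
                else Some false in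
      let c2 := if (2 <= i)%N
                then kand (mc w J i i.-2) (kand (sem w phi i.-2 nu)
                       (kneg (tp w i.-1)))
                else Some false in
      kor c0 (kor c1 c2)
  | FNext J phi =>
      let c0 := if `[< tset J = [set 0] >] then Some false
                else kand (mc w J i i) (kand (sem w phi i nu)
                       (kneg (tp w i))) in
      let c1 := if (i.+1 < size w)%N
                then kand (mc w J i.+1 i) (kand (sem w phi i.+1 nu)
                       (kand (tp w i.+1) (tp w i)))
                else Some false in
      let c2 := if (i.+2 < size w)%N
                then kand (mc w J i.+2 i) (kand (sem w phi i.+2 nu)
                       (kneg (tp w i.+1)))
                else Some false in
      kor c0 (kor c1 c2)
  | FSince J phi psi =>
      \big[kor/Some false]_(0 <= j < i.+1)
        kand (tp w j) (kand (mc w J i j) (kand (sem w psi j nu)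
          (\big[kand/Some true]_(j.+1 <= k < i.+1)
             kimp (tp w k) (sem w phi k nu))))
  | FUntil J phi psi =>
      \big[kor/Some false]_(i <= j < size w)
        kand (tp w j) (kand (mc w J j i) (kand (sem w psi j nu)
          (\big[kand/Some true]_(i <= k < j)
             kimp (tp w k) (sem w phi k nu))))
  end.

(* The time point with timestamp t, if any, is unique in an observation. *)
Definition sem_at (w : word) (phi : formula) (nu : V -> option D) (t : rat) :
    tv :=
  if [pick i : 'I_(size w) | `[< tset (itv_at w i) = [set t] >]] is Some i
  then sem w phi i nu else None.

Record timed_word := TimedWord {
  ts : nat -> rat;
  tpreds : nat -> forall p : P, set ((ar p).-tuple D);
  tregs : nat -> R -> D;
  ts_ge0 : forall j, 0 <= ts j;
  ts_mono : forall j, ts j < ts j.+1;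
  ts_nonzeno : forall t, exists j, t < ts j
}.

Fixpoint sat (v : timed_word) (phi : formula) (i : nat) (nu : V -> D) : Prop :=
  match phi with
  | FTrue => True
  | FPred p xs => tpreds v i (map_tuple nu xs)
  | FFreeze r x phi => sat v phi i [eta nu with x |-> tregs v i r]
  | FNeg phi => ~ sat v phi i nu
  | FOr phi psi => sat v phi i nu \/ sat v psi i nu
  | FPrev J phi =>
      [/\ (0 < i)%N, tset J (ts v i - ts v i.-1) & sat v phi i.-1 nu]
  | FNext J phi => tset J (ts v i.+1 - ts v i) /\ sat v phi i.+1 nu
  | FSince J phi psi =>
      exists j, [/\ (j <= i)%N, tset J (ts v i - ts v j), sat v psi j nu &
                    forall k, (j < k <= i)%N -> sat v phi k nu]
  | FUntil J phi psi =>
      exists j, [/\ (i <= j)%N, tset J (ts v j - ts v i), sat v psi j nu &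
                    forall k, (i <= k < j)%N -> sat v phi k nu]
  end.

Definition satB_at (v : timed_word) (phi : formula) (nu : V -> D) (t : rat) :
    tv :=
  match pselect (exists j, ts v j = t) with
  | left h => Some `[< sat v phi (projT1 (cid h)) nu >]
  | right _ => None
  end.

Definition covers (u : word) (v : timed_word) : Prop :=
  forall j, exists i,
    [/\ (i < size u)%N, tset (itv_at u i) (ts v j),
        extends (preds (letter_at u i)) (as_partial (tpreds v j)) &
        extends (regs (letter_at u i)) (as_partial (tregs v j))].

(* A time point of u records a position known to exist, so its timestamp has to
   occur in v.  Covering does not imply this: the timestamps of v may all avoid
   a singleton interval of u, and then [FTrue] is t at that timestamp in u and
   bottom in v. *)
Definition refines (u : word) (v : timed_word) : Prop :=
  covers u v /\
  forall i t, (i < size u)%N -> tset (itv_at u i) = [set t] ->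
    exists j, ts v j = t.

End MTL.

Arguments FTrue {P R ar V}.

(* Main.v *)
Require Import Defs.
From mathcomp Require Import all_boot all_order all_algebra.
From mathcomp Require Import boolp classical_sets.

Set Implicit Arguments.
Unset Strict Implicit.
Unset Printing Implicit Defensive.
Import Order.TTheory GRing.Theory Num.Theory.
Local Open Scope ring_scope.

(** The intervals of an observation are chronologically ordered and no two
    consecutive ones are both non-singletons.  Hence each position [j] of a
    refining timed word [v] lies in exactly one interval of [u]; this
    correspondence is monotone and is one-to-one at the time points of [u], all
    of which are hit.  By induction on the formula, its value at a position of
    [u] approximates its value at every position of [v] lying there. *)

(** * Inversion of the Kleene connectives and their iterated forms *)

Lemma kor_true a b : kor a b = Some true -> a = Some true \/ b = Some true.
Proof. by move: a b => [[]|] [[]|]; auto. Qed.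

Lemma kor_false a b : kor a b = Some false -> a = Some false /\ b = Some false.
Proof. by move: a b => [[]|] [[]|]. Qed.

Lemma kand_true a b : kand a b = Some true -> a = Some true /\ b = Some true.
Proof. by move: a b => [[]|] [[]|]. Qed.

Lemma kand_false a b : kand a b = Some false -> a = Some false \/ b = Some false.
Proof. by move: a b => [[]|] [[]|]; auto. Qed.

Lemma big_kor_true m n (F : nat -> tv) :
  \big[kor/Some false]_(m <= j < n) F j = Some true ->
  exists2 j, (m <= j < n)%N & F j = Some true.
Proof.
rewrite big_seq; elim/big_rec: _ => // j a + IH /kor_true[Fj|/IH//].
by rewrite mem_index_iota; exists j.
Qed.

Lemma big_kor_false m n (F : nat -> tv) :
  \big[kor/Some false]_(m <= j < n) F j = Some false ->
  forall j, (m <= j < n)%N -> F j = Some false.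
Proof.
move=> + j; rewrite -mem_index_iota; elim: (index_iota m n) => // k s IH.
by rewrite big_cons inE => /kor_false[Fk /IH{}IH] /predU1P[->|/IH].
Qed.

Lemma big_kand_true m n (F : nat -> tv) :
  \big[kand/Some true]_(m <= j < n) F j = Some true ->
  forall j, (m <= j < n)%N -> F j = Some true.
Proof.
move=> + j; rewrite -mem_index_iota; elim: (index_iota m n) => // k s IH.
by rewrite big_cons inE => /kand_true[Fk /IH{}IH] /predU1P[->|/IH].
Qed.

Lemma big_kand_false m n (F : nat -> tv) :
  \big[kand/Some true]_(m <= j < n) F j = Some false ->
  exists2 j, (m <= j < n)%N & F j = Some false.
Proof.
rewrite big_seq; elim/big_rec: _ => // j a + IH /kand_false[Fj|/IH//].
by rewrite mem_index_iota; exists j.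
Qed.

(** The order [kle] with the Boolean side left as a proposition, so that the induction can reason
    about [sat] directly and treat the values t and f separately. *)
Definition approx (a : tv) (Q : Prop) : Prop :=
  (a = Some true -> Q) /\ (a = Some false -> ~ Q).

Lemma approx_kle a Q : approx a Q -> kle a (Some `[< Q >]).
Proof.
case: a => [[]|] [aT aF]; [right|right|by left].
  by rewrite asboolT//; apply: aT.
by rewrite asboolF//; apply: aF.
Qed.

(** * Invariants of observations: order and separation of intervals *)

Lemma tpointP s t : tset (tpoint t) s -> s = t.
Proof. by case=> _ /=; rewrite in_itv /= => /le_anti. Qed.

Lemma tpoint_singleton t : 0 <= t -> is_singleton (tpoint t).
Proof.
move=> t0; exists t; apply/seteqP; split=> [s /tpointP//|s /= ->].
by split=> //=; rewrite in_itv /= lexx.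
Qed.

Lemma large_not_singleton (A : set rat) : is_large A -> ~ is_singleton A.
Proof.
move=> [s [t [As At /eqP st]]] [r Ar]; apply: st.
by move: As At; rewrite Ar /= => -> ->.
Qed.

Section Invariants.
Context {P R : finType} {ar : P -> nat} {D : Type}.
Implicit Types (x y : tinterval * letter R ar D) (w : word R ar D).

(** Vacuous when one of the intervals is empty, hence not transitive through empty intervals. This
    is why [well_formed] asks for it pairwise and not just between neighbours. *)
Definition before x y : bool :=
  `[< forall s t, tset x.1 s -> tset y.1 t -> s < t >].

Definition separated x y : bool :=
  `[< is_singleton x.1 >] || `[< is_singleton y.1 >].

Definition well_formed w : bool := pairwise before w && sorted separated w.

Lemma before_subr x y y' : (forall s, tset y'.1 s -> tset y.1 s) ->
  before x y -> before x y'.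
Proof. by move=> sub /asboolP xy; apply/asboolP => s t xs /sub; apply: xy. Qed.

Lemma before_subl x x' y : (forall s, tset x'.1 s -> tset x.1 s) ->
  before x y -> before x' y.
Proof. by move=> sub /asboolP xy; apply/asboolP => s t /sub; apply: xy. Qed.

(** Serves all four rules at once: [l] has three or two letters for a split, none for a removal and
    one for a data update. Passing to subsets preserves [before] on either side. *)
Lemma pairwise_before_subst w1 w2 x (l : word R ar D) :
  all (fun y => `[< forall s, tset y.1 s -> tset x.1 s >]) l ->
  pairwise before l ->
  pairwise before (w1 ++ x :: w2) -> pairwise before (w1 ++ l ++ w2).
Proof.
move=> lx lo; rewrite !pairwise_cat lo /= allrel_consr allrel_catr.
case/and3P=> /andP[w1x ->] -> /andP[xw2 ->]; rewrite !andbT /=.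
apply/andP; split.
  rewrite /allrel; apply: sub_all w1x => y /= yx.
  by apply: sub_all lx => z /asboolP /before_subr; apply.
rewrite /allrel; apply: sub_all lx => y /asboolP yx /=.
by apply: sub_all xw2 => z; apply: before_subl.
Qed.

Lemma sorted_rcons_sub w x y : (forall z, separated z x -> separated z y) ->
  sorted separated (rcons w x) -> sorted separated (rcons w y).
Proof.
by move=> xy; case: w => //= z w; rewrite !rcons_path => /andP[-> /xy].
Qed.

Lemma path_sub w x y : (forall z, separated x z -> separated y z) ->
  path separated x w -> path separated y w.
Proof. by move=> xy; case: w => //= z w /andP[/xy -> ->]. Qed.

Lemma separated_singletonl x y : is_singleton x.1 -> separated x y.
Proof. by move=> /asboolP xs; rewrite /separated xs. Qed.

Lemma separated_singletonr x y : is_singleton y.1 -> separated x y.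
Proof. by move=> /asboolP ys; rewrite /separated ys orbT. Qed.

Lemma separated_largel x y : is_large x.1 -> separated x y -> is_singleton y.1.
Proof.
by move=> /large_not_singleton xl; rewrite /separated asboolF//= => /asboolP.
Qed.

Lemma separated_larger x y : is_large y.1 -> separated x y -> is_singleton x.1.
Proof.
move=> /large_not_singleton yl.
by rewrite /separated orbC asboolF//= => /asboolP.
Qed.

(* The neighbours of a split or removed interval are singletons, so it does not
   matter whether the pieces of a split interval are empty. *)
Lemma well_formed_step w w' : obs_step w w' -> well_formed w -> well_formed w'.
Proof.
have subL (I : tinterval) a z A : is_large I ->
    separated z (I, a) -> separated z A.
  by move=> lI /separated_larger zs; apply/separated_singletonl/zs.
have subR (I : tinterval) a z A : is_large I ->
    separated (I, a) z -> separated A z.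
  by move=> lI /separated_largel zs; apply/separated_singletonr/zs.
case=> {w w'} [w1 w2 I a t lI It t0|w1 w2 I a lI I0|w1 w2 I a lI _
  |w1 w2 I a a' sI _] /andP[wo ws]; apply/andP; split.
- apply: (@pairwise_before_subst _ _ _ [:: _; _; _] _ _ wo) => /=.
    rewrite andbT; apply/and3P; split; apply/asboolP => s.
    + by case.
    + by move=> /tpointP ->.
    + by case.
  rewrite !andbT; apply/andP; split; last first.
    apply/asboolP => r s /tpointP ->.
    by case=> _; rewrite /= in_itv /= andbT.
  apply/andP; split; apply/asboolP => r s.
    by case=> _ /=; rewrite in_itv /= => /andP[_ rt] /tpointP ->.
  case=> _ /=; rewrite in_itv /= => /andP[_ rt] [_] /=.
  by rewrite in_itv /= andbT; apply: lt_trans.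
- move: ws; rewrite !sorted_cat_cons => /andP[ws1 ws2]; apply/andP; split.
    by apply: sorted_rcons_sub ws1 => z; apply: subL.
  rewrite /= separated_singletonr ?separated_singletonl/=;
    try by apply: tpoint_singleton; apply: ltW.
  by apply: path_sub ws2 => z; apply: subR.
- apply: (@pairwise_before_subst _ _ _ [:: _; _] _ _ wo) => /=.
    rewrite andbT; apply/andP; split; apply/asboolP => s.
    + by move=> /tpointP ->.
    + by case.
  rewrite !andbT; apply/asboolP => r s /tpointP ->.
  by case=> _; rewrite /= in_itv /= andbT.
- move: ws; rewrite !sorted_cat_cons => /andP[ws1 ws2]; apply/andP; split.
    by apply: sorted_rcons_sub ws1 => z; apply: subL.
  rewrite /= separated_singletonl/=; last exact: tpoint_singleton.
  by apply: path_sub ws2 => z; apply: subR.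
- exact: (@pairwise_before_subst _ _ _ [::] _ _ wo).
- move: ws; rewrite !sorted_cat_cons; case: w2 {wo} => [|z w2] /andP[ws1 /=].
    move=> _; rewrite cats0; case: w1 ws1 => //= z w1.
    by rewrite rcons_path => /andP[].
  case/andP=> /(subR _ _ _ _ lI) sep ws2.
  (* The removed interval is large, so its left neighbour, if any, is a singleton and may stand next
     to [z]. *)
  rewrite sorted_cat_cons ws2 andbT; apply: sorted_rcons_sub ws1 => y.
  by move=> /(subL _ _ _ _ lI).
- apply: (@pairwise_before_subst _ _ _ [:: _] _ _ wo) => //=.
  by rewrite andbT; apply/asboolP.
- move: ws; rewrite !sorted_cat_cons => /andP[ws1 ws2]; apply/andP; split.
    by apply: sorted_rcons_sub ws1.
  by apply: path_sub ws2.
Qed.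

Lemma observation_well_formed w : observation w -> well_formed w.
Proof.
elim=> [|w1 w2 _ IH st]; first by rewrite /well_formed.
exact: well_formed_step st IH.
Qed.

End Invariants.

(** * Correspondence between positions of [v] and positions of [u] *)

Section Approximation.
Context {P R : finType} {ar : P -> nat} {V : eqType} {D : Type}.
Variables (u : word R ar D) (v : timed_word R ar D).
Hypotheses (u_wf : well_formed u) (uv : refines u v).

Lemma itv_at_lt i k s t : (i < k < size u)%N ->
  tset (itv_at u i) s -> tset (itv_at u k) t -> s < t.
Proof.
case/andP=> ik ku; have [/pairwiseP] := andP u_wf.
move=> /(_ (nnegq, letter0 R ar D) i k); rewrite !inE.
move=> /(_ (ltn_trans ik ku) ku ik) /asboolP + _; apply.
Qed.

Lemma singleton_succ i : (i.+1 < size u)%N ->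
  is_singleton (itv_at u i) \/ is_singleton (itv_at u i.+1).
Proof.
have [_ /(sortedP (nnegq, letter0 R ar D)) sep] := andP u_wf.
by move=> /sep/orP[] /asboolP; [left|right].
Qed.

(** The bound on [i] matters: past the end of [u], [itv_at] defaults to [nnegq], which contains
    every timestamp. *)
Definition sits j i : Prop := (i < size u)%N /\ tset (itv_at u i) (ts v j).

Lemma ts_le j k : (ts v j <= ts v k) = (j <= k)%N.
Proof. exact/Order.NatMonotonyTheory.incnP/ts_mono. Qed.

Lemma ts_lt j k : (ts v j < ts v k) = (j < k)%N.
Proof. by rewrite ltNge ts_le -ltnNge. Qed.

Lemma sits_lt j k i i' : sits j i -> sits k i' -> (i < i')%N -> (j < k)%N.
Proof.
move=> [_ ji] [i'u ki'] ii'; rewrite -ts_lt.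
by apply: itv_at_lt ji ki'; rewrite ii'.
Qed.

Lemma sits_le j k i i' : sits j i -> sits k i' -> (j <= k)%N -> (i <= i')%N.
Proof.
move=> ji ki'; rewrite (leqNgt j) (leqNgt i).
by apply: contra; apply: sits_lt ki' ji.
Qed.

Lemma sits_uniq j i i' : sits j i -> sits j i' -> i = i'.
Proof.
move=> ji ji'; apply/eqP.
by rewrite eqn_leq (sits_le ji ji') // (sits_le ji' ji).
Qed.

Lemma sits_singleton_inj i j k :
  is_singleton (itv_at u i) -> sits j i -> sits k i -> j = k.
Proof.
move=> [t it] [_ +] [_ +]; rewrite it /= => <- kj.
by apply/eqP; rewrite eqn_leq -!ts_le kj lexx.
Qed.

(** A non-singleton interval may hold many positions of [v], so strictness carries over to [u] only
    when one of the two intervals is a singleton; here it is the left one. *)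
Lemma sits_ltl j k i i' : is_singleton (itv_at u i) ->
  sits j i -> sits k i' -> (j < k)%N -> (i < i')%N.
Proof.
move=> iS ji ki' jk; rewrite ltn_neqAle (sits_le ji ki' (ltnW jk)) andbT.
apply: contraTneq jk => ii'; subst i'.
by rewrite (sits_singleton_inj iS ji ki') ltnn.
Qed.

Lemma sits_ltr j k i i' : is_singleton (itv_at u i') ->
  sits j i -> sits k i' -> (j < k)%N -> (i < i')%N.
Proof.
move=> iS ji ki' jk; rewrite ltn_neqAle (sits_le ji ki' (ltnW jk)) andbT.
apply: contraTneq jk => ii'; subst i'.
by rewrite (sits_singleton_inj iS ji ki') ltnn.
Qed.

(** Covering does not provide this; it is the second clause of [refines]. *)
Lemma singleton_sits i : (i < size u)%N -> is_singleton (itv_at u i) ->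
  exists j, sits j i.
Proof.
move=> iu [t it]; have [j jt] := uv.2 _ _ iu it.
by exists j; split; rewrite // it.
Qed.

Lemma sits_total j : exists i, sits j i.
Proof. by have [i [? ? _ _]] := uv.1 j; exists i. Qed.

(** A time point in between would hold a position of [v] strictly between [j] and [j.+1]. *)
Lemma sits_succ_gap j i i' k : sits j i -> sits j.+1 i' -> (i < k < i')%N ->
  ~ is_singleton (itv_at u k).
Proof.
move=> ji ji' /andP[ik ki'] kS.
have [l lk] := singleton_sits (ltn_trans ki' ji'.1) kS.
have := sits_lt ji lk ik; rewrite leqNgt => /negP; apply.
exact: sits_lt lk ji' ki'.
Qed.

(** Skipped intervals are not singletons, and two such intervals are never adjacent, so at most one
    is skipped. The three outcomes match the three disjuncts in the semantics of [FPrev] and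
    [FNext]. *)
Lemma sits_succ_bound j i i' : sits j i -> sits j.+1 i' ->
  [\/ i' = i, i' = i.+1 | i' = i.+2 /\ ~ is_singleton (itv_at u i.+1)].
Proof.
move=> ji ji'; have gap := sits_succ_gap ji ji'.
have := sits_le ji ji' (leqnSn j).
rewrite leq_eqVlt => /predU1P[->|ii']; first by constructor.
move: ii'; rewrite leq_eqVlt => /predU1P[<-|ii']; first by constructor.
have n1 : ~ is_singleton (itv_at u i.+1) by apply: gap; rewrite ltnSn.
move: ii'; rewrite leq_eqVlt => /predU1P[<-|ii']; first by constructor.
have i2u : (i.+2 < size u)%N by apply: ltn_trans ii' ji'.1.
by case: (singleton_succ i2u) => // /gap; case; rewrite ii' leqnSn.
Qed.

Lemma sits_succ_adjacent j k i : sits j i -> sits k i.+1 ->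
  is_singleton (itv_at u i) -> is_singleton (itv_at u i.+1) -> k = j.+1.
Proof.
move=> ji ki iS iS'; have jk := sits_lt ji ki (ltnSn i).
have [i' ji'] := sits_total j.+1.
suff ii' : i.+1 = i' by move: ji'; rewrite -ii'; apply: sits_singleton_inj.
apply/eqP; rewrite eqn_leq (sits_le ji' ki jk).
by rewrite (sits_ltl iS ji ji' (ltnSn j)).
Qed.

(** * Time points, metric constraints and atoms *)

Lemma tp_true i : tp u i = Some true -> is_singleton (itv_at u i).
Proof. by rewrite /tp; case: asboolP. Qed.

Lemma tp_neq_false i : tp u i <> Some false.
Proof. by rewrite /tp; case: asboolP. Qed.

Lemma kneg_tp_neq_true i : kneg (tp u i) <> Some true.
Proof. by rewrite /tp; case: asboolP. Qed.

Lemma kneg_tp_false i : kneg (tp u i) = Some false -> is_singleton (itv_at u i).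
Proof. by rewrite /tp; case: asboolP. Qed.

(** The actual time difference is a member of [tdiff]; as [tdiff] keeps only nonnegative
    differences, [j <= k] is required. *)
Lemma mc_true J i i' j k : sits j i -> sits k i' -> (j <= k)%N ->
  mc u J i' i = Some true -> tset J (ts v k - ts v j).
Proof.
rewrite -ts_le => -[_ ji] [_ ki'] jk; rewrite /mc; case: asboolP.
  move=> [_ sub] _; apply: sub; split; first by rewrite subr_ge0.
  by exists (ts v k), (ts v j).
by case: asboolP.
Qed.

Lemma mc_false J i i' j k : sits j i -> sits k i' -> (j <= k)%N ->
  mc u J i' i = Some false -> ~ tset J (ts v k - ts v j).
Proof.
rewrite -ts_le => -[_ ji] [_ ki'] jk; rewrite /mc; case: asboolP => // _.
case: asboolP => // d0 _ Jd.
suff : (tdiff (itv_at u i') (itv_at u i) `&` J)%classic (ts v k - ts v j).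
  by rewrite d0.
split => //; split; first by rewrite subr_ge0.
by exists (ts v k), (ts v j).
Qed.

Lemma atom_approx n (X : option (set (n.-tuple D))) A (xs : n.-tuple V)
    (mu : V -> option D) (nu : V -> D) :
  (forall B, X = Some B -> A = B) -> extends mu (as_partial nu) ->
  approx (atom X xs mu) (A (map_tuple nu xs)).
Proof.
move=> XA munu.
(* If [mu] is defined on all of [xs], then [nu] takes the same values there. *)
have nuE ds : map_tuple mu xs = map_tuple Some ds -> map_tuple nu xs = ds.
  move=> /(congr1 (fun t => tnth t)) h; apply: eq_from_tnth => i.
  move: (congr1 (@^~ i) h); rewrite !tnth_map => /munu.
  by rewrite /as_partial => -[].
rewrite /atom; case: asboolP => [[ds [B [/nuE -> /XA -> Bds]]]|_].
  by split.
by case: asboolP => [[ds [B [/nuE -> /XA -> Bds]]]|_]; split.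
Qed.

(** * Soundness of each operator *)

Lemma kneg_approx a Q : approx a Q -> approx (kneg a) (~ Q).
Proof.
case: a => [[]|] [aT aF]; split=> // _; last exact: aF.
by apply; apply: aT.
Qed.

Lemma kor_approx a b Q Q' :
  approx a Q -> approx b Q' -> approx (kor a b) (Q \/ Q').
Proof.
move=> [aT aF] [bT bF]; split; first by case/kor_true; auto.
by case/kor_false=> /aF nQ /bF nQ' [].
Qed.

Lemma extends_update (mu : V -> option D) (nu : V -> D) x (c : option D) d :
  (forall e, c = Some e -> d = e) -> extends mu (as_partial nu) ->
  extends [eta mu with x |-> c] (as_partial [eta nu with x |-> d]).
Proof.
move=> cd munu y e; rewrite /as_partial /=.
by case: eqP => [_ /cd ->//|_]; apply: munu.
Qed.

Definition sound (phi : formula R ar V) : Prop := forall i j mu nu,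
  sits j i -> extends mu (as_partial nu) ->
  approx (sem u phi i mu) (sat v phi j nu).

Lemma sound_prev J phi : sound phi -> sound (FPrev J phi).
Proof.
move=> IH i j mu nu ji munu; split=> /=.
  (* Only the disjunct for two adjacent time points can be t: the other two contain a negated [tp],
     which is never t. *)
  case/kor_true.
    case: asboolP => // _ /kand_true[_ /kand_true[_]].
    by move=> /kneg_tp_neq_true.
  case/kor_true; last first.
    case: ifP => // _ /kand_true[_ /kand_true[_]].
    by move=> /kneg_tp_neq_true.
  case: i ji => // i ji /= /kand_true[mcT /kand_true[phiT]].
  case/kand_true=> /tp_true iS /tp_true iS'.
  have [k ki] := singleton_sits (ltnW ji.1) iS.
  have jk := sits_succ_adjacent ki ji iS iS'; subst j.
  by split=> //=; [exact: mc_true mcT|have [+ _] := IH _ _ _ _ ki munu; apply].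
case/kor_false=> c0 /kor_false[c1 c2] [].
(* If the formula held at [j], there would be a predecessor. Its position in [u] selects one
   disjunct, which is shown not to be f. *)
case: j ji => // j ji _ /= Jj sj.
have [i' ji'] := sits_total j.
have nF : sem u phi i' mu <> Some false.
  by move=> F; have [_ /(_ F)] := IH _ _ _ _ ji' munu.
have nmc : mc u J i i' <> Some false.
  by move=> /(mc_false ji' ji (leqnSn j)).
case: (sits_succ_bound ji' ji) => [ii'|ii'|[ii' nS]]; subst i.
(* Both positions share one interval. The constraint {0} would force equal timestamps, and a
   singleton would force equal positions. *)
- move: c0; case: asboolP => [J0 _|_].
    move: Jj; rewrite J0 /= => /eqP; rewrite subr_eq0 => /eqP tsj.
    by have := ts_mono v j; rewrite tsj ltxx.
  case/kand_false=> // /kand_false[] // /kneg_tp_false iS.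
  have /eqP := sits_singleton_inj iS ji' ji.
  by rewrite eqn_leq ltnn andbF.
- move: c1 => /= /kand_false[//|/kand_false[//|/kand_false[]]];
    exact: tp_neq_false.
- by move: c2 => /= /kand_false[//|/kand_false[//|/kneg_tp_false]].
Qed.

Lemma sound_next J phi : sound phi -> sound (FNext J phi).
Proof.
move=> IH i j mu nu ji munu; split=> /=.
  case/kor_true.
    case: asboolP => // _ /kand_true[_ /kand_true[_]].
    by move=> /kneg_tp_neq_true.
  case/kor_true; last first.
    case: ifP => // _ /kand_true[_ /kand_true[_]].
    by move=> /kneg_tp_neq_true.
  (* Here [iu] places the next letter inside [u], so that as a time point it holds a position of
     [v]. *)
  case: ifP => // iu /kand_true[mcT /kand_true[phiT]].
  case/kand_true=> /tp_true iS' /tp_true iS.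
  have [k ki] := singleton_sits iu iS'.
  have jk := sits_succ_adjacent ji ki iS iS'; subst k.
  by split; [exact: mc_true mcT|have [+ _] := IH _ _ _ _ ki munu; apply].
case/kor_false=> c0 /kor_false[c1 c2] [Jj sj].
have [i' ji'] := sits_total j.+1.
have nF : sem u phi i' mu <> Some false.
  by move=> F; have [_ /(_ F)] := IH _ _ _ _ ji' munu.
have nmc : mc u J i' i <> Some false.
  by move=> /(mc_false ji ji' (leqnSn j)).
case: (sits_succ_bound ji ji') => [ii'|ii'|[ii' nS]]; subst i'.
- move: c0; case: asboolP => [J0 _|_].
    move: Jj; rewrite J0 /= => /eqP; rewrite subr_eq0 => /eqP tsj.
    by have := ts_mono v j; rewrite tsj ltxx.
  case/kand_false=> // /kand_false[] // /kneg_tp_false iS.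
  have /eqP := sits_singleton_inj iS ji ji'.
  by rewrite eqn_leq ltnn andbF.
- move: c1; rewrite ji'.1.
  by move=> /kand_false[//|/kand_false[//|/kand_false[]]] /tp_neq_false.
- move: c2; rewrite ji'.1.
  by move=> /kand_false[//|/kand_false[//|/kneg_tp_false]].
Qed.

(** Since [tp] is never f, a true implication gives its conclusion even at non-singleton intervals,
    and so at every position of [v] lying there. *)
Lemma kimp_tp_true i a : kimp (tp u i) a = Some true -> a = Some true.
Proof. by rewrite /tp; case: asboolP => _; case: a => [[]|]. Qed.

(** A failure can only come from a time point, where a position of [v] exists to witness it. *)
Lemma kimp_tp_false i a : kimp (tp u i) a = Some false ->
  is_singleton (itv_at u i) /\ a = Some false.
Proof. by rewrite /tp; case: asboolP => [iS|_]; case: a => [[]|]. Qed.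

Lemma sound_since J phi psi :
  sound phi -> sound psi -> sound (FSince J phi psi).
Proof.
move=> IHphi IHpsi i j mu nu ji munu; split=> /=.
  case/big_kor_true=> i' /andP[_ ii'] /kand_true[/tp_true iS].
  case/kand_true=> mcT /kand_true[psiT /big_kand_true phiT].
  have [k ki'] := singleton_sits (leq_trans ii' ji.1) iS.
  have kj : (k <= j)%N.
    (* If [i'] is [i] itself, then [j] and [k] lie in the same singleton and coincide. *)
    move: ii'; rewrite ltnS leq_eqVlt => /predU1P[ii'|ii'].
      by subst i'; rewrite (sits_singleton_inj iS ki' ji).
    exact/ltnW/(sits_lt ki' ji).
  exists k; split=> //; first exact: mc_true mcT.
    by have [+ _] := IHpsi _ _ _ _ ki' munu; apply.
  move=> l /andP[kl lj]; have [h lh] := sits_total l.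
  have [+ _] := IHphi _ _ _ _ lh munu; apply.
  (* [h] lies strictly after [i'] because [i'] is a time point and [l] comes after [k]. *)
  apply: kimp_tp_true (phiT h _).
  by rewrite (sits_ltl iS ki' lh kl) ltnS (sits_le lh ji lj).
move=> /big_kor_false allF [k [kj Jk psik phil]].
(* The disjunct of the position holding the Boolean witness [k] is f. Its first three conjuncts are
   not f, so [phi] is f at some time point [h] after [i']. *)
have [i' ki'] := sits_total k.
have := allF i'; rewrite /= ltnS (sits_le ki' ji kj) => /(_ isT).
case/kand_false=> [/tp_neq_false//|/kand_false[|/kand_false[]]].
- by move/(mc_false ki' ji kj).
- by move=> F; have [_ /(_ F)] := IHpsi _ _ _ _ ki' munu.
case/big_kand_false=> h /andP[i'h hi] /kimp_tp_false[hS phiF].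
have [l lh] := singleton_sits (leq_trans hi ji.1) hS.
have [_ /(_ phiF)] := IHphi _ _ _ _ lh munu; apply; apply: phil.
(* The position [l] at [h] satisfies [k < l <= j]; a later [l] would put [h] beyond [i], as [h] is a
   time point. *)
rewrite (sits_lt ki' lh i'h) leqNgt /=; apply/negP => jl.
by have := sits_ltr hS ji lh jl; rewrite ltnNge -ltnS hi.
Qed.

Lemma sound_until J phi psi :
  sound phi -> sound psi -> sound (FUntil J phi psi).
Proof.
move=> IHphi IHpsi i j mu nu ji munu; split=> /=.
  case/big_kor_true=> i' /andP[ii' i'u] /kand_true[/tp_true iS].
  case/kand_true=> mcT /kand_true[psiT /big_kand_true phiT].
  have [k ki'] := singleton_sits i'u iS.
  have jk : (j <= k)%N.
    by rewrite leqNgt; apply/negP => /(sits_ltl iS ki' ji); rewrite ltnNge ii'.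
  exists k; split=> //; first exact: mc_true mcT.
    by have [+ _] := IHpsi _ _ _ _ ki' munu; apply.
  move=> l /andP[jl lk]; have [h lh] := sits_total l.
  have [+ _] := IHphi _ _ _ _ lh munu; apply.
  apply: kimp_tp_true (phiT h _).
  (* Time runs forward here: the time point [i'] is the right end, which makes [h < i'] strict. *)
  by rewrite (sits_ltr iS lh ki' lk) (sits_le ji lh jl).
move=> /big_kor_false allF [k [jk Jk psik phil]].
have [i' ki'] := sits_total k.
have := allF i'; rewrite ki'.1 (sits_le ji ki' jk) => /(_ isT).
case/kand_false=> [/tp_neq_false//|/kand_false[|/kand_false[]]].
- by move/(mc_false ji ki' jk).
- by move=> F; have [_ /(_ F)] := IHpsi _ _ _ _ ki' munu.
case/big_kand_false=> h /andP[ih hi'] /kimp_tp_false[hS phiF].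
have [l lh] := singleton_sits (ltn_trans hi' ki'.1) hS.
have [_ /(_ phiF)] := IHphi _ _ _ _ lh munu; apply; apply: phil.
rewrite (sits_lt lh ki' hi') andbT leqNgt; apply/negP => lj.
by have := sits_ltl hS lh ji lj; rewrite ltnNge ih.
Qed.

Lemma sem_sound phi : sound phi.
Proof.
elim: phi => [|p xs|r x phi IH|phi IH|phi IHphi psi IHpsi|J phi|J phi
  |J phi IHphi psi IHpsi|J phi IHphi psi IHpsi].
- by move=> i j mu nu _ _; split.
- move=> i j mu nu ji munu; have [i' [i'u ji' pe _]] := uv.1 j.
  rewrite (sits_uniq ji (conj i'u ji')) /=; apply: atom_approx munu.
  by move=> B /pe [].
- move=> i j mu nu ji munu; have [i' [i'u ji' _ re]] := uv.1 j.
  apply: (IH _ _ _ _ ji); apply: extends_update munu.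
  by rewrite (sits_uniq ji (conj i'u ji')) => e /re [].
- by move=> i j mu nu ji munu; apply/kneg_approx/IH.
- by move=> i j mu nu ji munu; apply: kor_approx; [apply: IHphi|apply: IHpsi].
- exact: sound_prev.
- exact: sound_next.
- exact: sound_since.
- exact: sound_until.
Qed.

End Approximation.

Unset Implicit Arguments.

Theorem theorem3p5 (P R : finType) (ar : P -> nat) (V : eqType) (D : Type)
    (D_nonempty : inhabited D)
    (phi : formula R ar V) (mu : V -> option D) (nu : V -> D)
    (u : word R ar D) (v : timed_word R ar D) (tau : rat)
    (u_obs : observation u) (tau_ge0 : 0 <= tau) :
  refines u v -> extends mu (as_partial nu) ->
  kle (sem_at u phi mu tau) (satB_at v phi nu tau).
Proof.
move=> uv munu; rewrite /sem_at; case: pickP => [i /asboolP iE|_]; last by left.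
(* A time point of [u] at [tau] forces [tau] to occur in [v], so the Boolean value is defined. *)
rewrite /satB_at; case: pselect => [h|[]]; last exact: uv.2 (ltn_ord i) iE.
(* Any position with timestamp [tau] lies in interval [i], so the choice made by [cid] is
   harmless. *)
apply: approx_kle; case: (cid h) => j /= jtau.
apply: sem_sound munu => //; first exact: observation_well_formed.
by split; rewrite ?ltn_ord // iE.
Qed.
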